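(* Let $f$ be a discrete probability mass function with finite support $\{x_k: k=0,\dots,N\}\subset[0,1]$, with $p_k=f(x_k)$, and let $F(x)=\sum_{k=0}^N p_k\, I_{[0,x)}(x_k)$ be the corresponding cumulative distribution function. For $\alpha\in\mathbb{N}_+$ let $F_\alpha$ be the moment approximation of $F$ given by $$F_\alpha(x)=\sum_{k=0}^{[\alpha x]}\ \sum_{j=k}^{\alpha}\binom{\alpha}{j}\binom{j}{k}(-1)^{j-k}\,m(j,dF),\qquad x\in[0,1].$$ Then for each $x\in[0,1]$, $F_\alpha(x)\to F(x)$ as $\alpha\to\infty$.
   Context: $\mathbb{N}_+$ denotes the positive integers, $[u]$ is the integer part of $u$, and $I_{[0,x)}$ is the indicator function of the interval $[0,x)$. The moments of $F$ are $$m(j,dF)=\sum_{k=0}^N x_k^j\,p_k=\int_0^1 t^j\,dF(t),\qquad j=0,1,2,\dots,$$ where the integral is with respect to the discrete probability measure assigning mass $p_k$ to $x_k$.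
   Formalization: Convergence is stated only for x in [0,1] that is not one of the support points x_k; at every support point the claim as written fails (e.g. unit mass at 0, x = 0: F_α(0) = 1 for all α but F(0) = 0). *)

(* Defs.v *)
From HB Require Import structures.
From mathcomp Require Import all_boot all_order all_algebra.
From mathcomp Require Import all_classical all_reals all_analysis.

Set Implicit Arguments.
Unset Strict Implicit.
Unset Printing Implicit Defensive.

Import Order.TTheory GRing.Theory Num.Theory.
Import numFieldNormedType.Exports.

Local Open Scope classical_set_scope.
Local Open Scope ring_scope.

(** [xs] enumerates the support of [f] without repetition; in particular each
    weight [f (xs k)] is positive. *)
Record is_pmf_on (R : realType) (N : nat) (f : R -> R) (xs : 'I_N.+1 -> R) :
    Prop := IsPmfOn {
  pmf_ge0 : forall t, 0 <= f t ;
  pmf_support : [set t | f t != 0] = range xs ;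
  pmf_support_inj : injective xs ;
  pmf_support01 : forall k, xs k \in `[0, 1] ;
  pmf_sum1 : \sum_(k < N.+1) f (xs k) = 1
}.

(** The half-open interval makes this P(X < x): left-continuous, with an atom
    at [x] not counted. *)
Definition pmf_cdf (R : realType) (N : nat) (f : R -> R) (xs : 'I_N.+1 -> R)
    (x : R) : R :=
  \sum_(k < N.+1) f (xs k) * \1_(`[0, x[%classic) (xs k).

(** The zeroth moment is 1 even when 0 is an atom, since [0 ^+ 0 = 1]. *)
Definition pmf_moment (R : realType) (N : nat) (f : R -> R) (xs : 'I_N.+1 -> R)
    (j : nat) : R :=
  \sum_(k < N.+1) xs k ^+ j * f (xs k).

(** [Num.truncn] is the integer part on nonnegative reals. *)
Definition moment_approx (R : realType) (m : nat -> R) (alpha : nat) (x : R) :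
    R :=
  \sum_(0 <= k < (Num.truncn (alpha%:R * x)).+1)
    \sum_(k <= j < alpha.+1)
      'C(alpha, j)%:R * 'C(j, k)%:R * (-1) ^+ (j - k) * m j.

(* Main.v *)
Require Import Defs.
From HB Require Import structures.
From mathcomp Require Import all_boot all_order all_algebra.
From mathcomp Require Import all_classical all_reals all_analysis.
From mathcomp Require Import ring lra.

(** The inner sum over j of the moment approximation is the inclusion-exclusion
    form of a Bernstein polynomial: replacing the moment of order j by t^j, it is
    C(alpha, k) t^k (1 - t)^(alpha - k) ([bernstein_expansion]). By linearity
    ([moment_approx_pmf]) the approximation at x is therefore
    the average, over the atoms t, of the probability that a binomial variable
    with parameters alpha and t is at most alpha x.

    Divided by alpha, such a variable concentrates at t. Hence this probability
    tends to 1 when t < x and to 0 when x < t, which is the indicator that the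
    distribution function averages over the atoms. At t = x the threshold
    coincides with the mean and concentration says nothing; this is why x must
    avoid the atoms. The concentration is quantified by Chebyshev's inequality
    ([binomial_chebyshev]), with error at most 1 / (alpha (x - t)^2)
    ([bernstein_step_dist]). The binomial variance is obtained by
    induction on the number of trials, from the recurrence [binomial_sumS]. *)

Import Order.TTheory GRing.Theory Num.Theory.
Import numFieldNormedType.Exports.

Local Open Scope classical_set_scope.
Local Open Scope ring_scope.

(** Both sides are the multinomial coefficient n! / (k! i! (n - k - i)!), so
    the identity is checked after multiplying by the denominator. *)
Lemma bin_mul_bin (n k i : nat) : (i + k <= n)%N ->
  ('C(n, i + k) * 'C(i + k, k) = 'C(n, k) * 'C(n - k, i))%N.
Proof.
move=> ikn.
have kn : (k <= n)%N := leq_trans (leq_addl i k) ikn.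
have ink : (i <= n - k)%N by rewrite leq_subRL // addnC.
have fact3_gt0 : (0 < k`! * (i`! * (n - k - i)`!))%N.
  by rewrite !muln_gt0 !fact_gt0.
apply/eqP; rewrite -(eqn_pmul2r fact3_gt0); apply/eqP.
have nik := bin_fact ikn; have ikk := bin_fact (leq_addl i k).
have nk := bin_fact kn; have nki := bin_fact ink.
rewrite addnK in ikk; rewrite addnC subnDA in nik; rewrite (addnC i k) in ikk *.
by transitivity n`!; [rewrite -nik -ikk | rewrite -nk -nki]; ring.
Qed.

Lemma binomial_pmfE (R : realType) (n k : nat) (t : R) :
  binomial_pmf n t k = 'C(n, k)%:R * (t ^+ k * (1 - t) ^+ (n - k)).
Proof. by rewrite mulr_natl. Qed.

(** This is what the alternating sum of moments means: expanding
    [(1 - t) ^+ (n - k)] in powers of [t] turns the Bernstein polynomial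
    C(n, k) t^k (1 - t)^(n - k) into that combination of monomials. *)
Lemma bernstein_expansion (R : realType) (n k : nat) (t : R) :
  \sum_(k <= j < n.+1) 'C(n, j)%:R * 'C(j, k)%:R * (-1) ^+ (j - k) * t ^+ j =
  binomial_pmf n t k.
Proof.
rewrite binomial_pmfE; have [nk|kn] := ltnP n k.
  by rewrite bin_small // mul0r big_geq.
rewrite -{1}[k]add0n big_addn subSn // big_mkord exprBn.
rewrite !mulr_sumr; apply: eq_bigr => i _.
have ikn : (i + k <= n)%N by rewrite addnC -leq_subRL // -ltnS.
rewrite addnK -natrM bin_mul_bin // natrM exprD expr1n -[_ *+ _]mulr_natl.
by ring.
Qed.

(** The approximation is linear in the moments, and the moments are linear in
    the point masses, so only the moments t^j of a point mass at t matter. *)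
Lemma moment_approx_pmf (R : realType) (N n : nat) (f : R -> R)
    (xs : 'I_N.+1 -> R) (x : R) :
  moment_approx (pmf_moment f xs) n x =
  \sum_(i < N.+1) f (xs i) *
    \sum_(0 <= k < (Num.truncn (n%:R * x)).+1) binomial_pmf n (xs i) k.
Proof.
rewrite /moment_approx /pmf_moment.
under [RHS]eq_bigr do rewrite mulr_sumr.
rewrite [RHS]exchange_big /=; apply: eq_bigr => k _.
under eq_bigr do rewrite mulr_sumr.
rewrite exchange_big /=; apply: eq_bigr => i _.
rewrite -bernstein_expansion mulr_sumr; apply: eq_bigr => j _.
by rewrite mulrA mulrC.
Qed.

Lemma binomial_pmf_small (R : realType) (n k : nat) (t : R) : (n < k)%N ->
  binomial_pmf n t k = 0.
Proof. by move=> nk; rewrite binomial_pmfE bin_small // mul0r. Qed.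

Lemma binomial_pmfS0 (R : realType) (n : nat) (t : R) :
  binomial_pmf n.+1 t 0 = (1 - t) * binomial_pmf n t 0.
Proof. by rewrite !binomial_pmfE !bin0 !subn0 exprS; ring. Qed.

(** Conditioning on the last trial. *)
Lemma binomial_pmfSS (R : realType) (n k : nat) (t : R) :
  binomial_pmf n.+1 t k.+1 =
  (1 - t) * binomial_pmf n t k.+1 + t * binomial_pmf n t k.
Proof.
have [kn|nk] := ltnP k n; last first.
  by rewrite (@binomial_pmf_small _ n k.+1) // !binomial_pmfE binS subSS
    (@bin_small n k.+1) // mulr0 !add0r exprS; ring.
rewrite !binomial_pmfE binS natrD subSS -(subnSK kn) !exprS.
by ring.
Qed.

(** The recurrence for expectations under the binomial law: [n.+1] trials are
    [n] trials followed by one more, whose success shifts the argument of [g].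
    It reduces every moment computation to an induction on [n]. *)
Lemma binomial_sumS (R : realType) (n : nat) (t : R) (g : nat -> R) :
  \sum_(0 <= k < n.+2) binomial_pmf n.+1 t k * g k =
  (1 - t) * (\sum_(0 <= k < n.+1) binomial_pmf n t k * g k) +
  t * (\sum_(0 <= k < n.+1) binomial_pmf n t k * g k.+1).
Proof.
rewrite big_nat_recl // binomial_pmfS0.
under eq_bigr do rewrite binomial_pmfSS mulrDl -!mulrA.
rewrite big_split /= -!mulr_sumr addrA -mulrA -mulrDr; congr (_ * _ + _).
pose h k := binomial_pmf n t k * g k.
rewrite -[LHS](@big_nat_recl _ _ _ n.+1 0%N h) // big_nat_recr //= {2}/h.
by rewrite binomial_pmf_small // mul0r addr0.
Qed.

Lemma binomial_pmf_sum1 (R : realType) (n : nat) (t : R) :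
  \sum_(0 <= k < n.+1) binomial_pmf n t k = 1.
Proof.
under eq_bigr do rewrite -[binomial_pmf _ _ _]mulr1.
elim: n => [|n IHn].
  by rewrite big_nat1 binomial_pmfE bin0 !expr0; ring.
by rewrite binomial_sumS IHn; ring.
Qed.

(** Variance plus squared bias. The centre [c] is arbitrary, not the mean, so
    that the induction goes through: a success replaces [c] by [c - 1]. *)
Lemma binomial_second_moment (R : realType) (n : nat) (t c : R) :
  \sum_(0 <= k < n.+1) binomial_pmf n t k * (k%:R - c) ^+ 2 =
  n%:R * t * (1 - t) + (n%:R * t - c) ^+ 2.
Proof.
elim: n c => [|n IHn] c.
  by rewrite big_nat1 binomial_pmfE bin0 !expr0; ring.
rewrite binomial_sumS IHn.
have shift k : k.+1%:R - c = k%:R - (c - 1) by ring.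
under eq_bigr do rewrite shift.
by rewrite IHn; ring.
Qed.

(** Chebyshev's inequality, with [P] any set of values at distance at least [d]
    from the mean; the two tails are both instances of it. *)
Lemma binomial_chebyshev (R : realType) (n : nat) (t d : R) (P : pred nat) :
  0 <= t <= 1 -> 0 <= d -> (forall k, P k -> d <= `|k%:R - n%:R * t|) ->
  d ^+ 2 * (\sum_(0 <= k < n.+1 | P k) binomial_pmf n t k) <=
  n%:R * t * (1 - t).
Proof.
move=> t01 d0 far.
have -> : n%:R * t * (1 - t) =
    \sum_(0 <= k < n.+1) binomial_pmf n t k * (k%:R - n%:R * t) ^+ 2.
  by rewrite binomial_second_moment; ring.
rewrite mulr_sumr big_mkcond /=; apply: ler_sum => k _.
have pmf0 : 0 <= binomial_pmf n t k by exact: binomial_pmf_ge0.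
case: ifPn => [/far dk|_]; last by rewrite mulr_ge0 // sqr_ge0.
rewrite mulrC ler_wpM2l // -(real_normK (num_real (k%:R - _))).
by rewrite ler_pXn2r // nnegrE.
Qed.

(** The partial sum is the probability that a binomial variable with parameters
    [n.+1] and [t] is at most [n.+1%:R * x]. Its mean [n.+1%:R * t] lies at
    distance [n.+1%:R * `|x - t|] from this threshold, whereas the variance is
    only of order [n.+1]; the bound is Chebyshev's with t (1 - t) <= 1. *)
Lemma bernstein_step_dist (R : realType) (n : nat) (t x : R) :
  0 <= t <= 1 -> x \in `[0, 1] -> t != x ->
  `|(t < x)%R%:R - \sum_(0 <= k < (Num.truncn (n.+1%:R * x)).+1)
                      binomial_pmf n.+1 t k| <=
  ((x - t) ^+ 2)^-1 * n.+1%:R^-1.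
Proof.
move=> t01; rewrite in_itv /= => /andP[x0 x1] tx.
set m := Num.truncn _; set s := \sum_(_ <= _ < _) _.
have n0 : 0 < n.+1%:R :> R by rewrite ltr0Sn.
have nx0 : 0 <= n.+1%:R * x by rewrite mulr_ge0 // ltW.
have mn : (m.+1 <= n.+2)%N.
  rewrite ltnS -(ler_nat R); apply: le_trans (_ : n.+1%:R * x <= _).
    by rewrite truncn_le.
  by rewrite ler_piMr // ltW.
have sE : s = \sum_(0 <= k < n.+2 | (k <= m)%N) binomial_pmf n.+1 t k.
  by rewrite /s (big_nat_widen _ _ _ _ _ mn).
have xt2 : 0 < (x - t) ^+ 2 by rewrite exprn_even_gt0 //= subr_eq0 eq_sym.
(* The set is the upper tail when t < x and the lower tail when x < t. *)
suff [P [-> far]] : exists P : pred nat,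
    `|(t < x)%R%:R - s| = \sum_(0 <= k < n.+2 | P k) binomial_pmf n.+1 t k /\
    (forall k, P k -> n.+1%:R * `|x - t| <= `|k%:R - n.+1%:R * t|).
  have d0 : 0 <= n.+1%:R * `|x - t| by rewrite mulr_ge0 // ltW.
  have := binomial_chebyshev _ _ _ _ _ t01 d0 far.
  set p := \sum_(_ <= _ < _ | _) _ => cheb.
  rewrite -invfM -div1r (ler_pdivlMr _ _ (mulr_gt0 xt2 n0)).
  rewrite -(ler_pM2l n0); apply: (le_trans (_ : _ <= n.+1%:R * t * (1 - t))).
    apply: le_trans cheb; rewrite exprMn real_normK ?num_real //.
    by rewrite [leLHS](_ : _ = n.+1%:R ^+ 2 * (x - t) ^+ 2 * p) //; ring.
  have : t * (1 - t) <= 1 by nra.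
  by rewrite -mulrA ler_pM2l.
have s0 (Q : pred nat) : 0 <= \sum_(0 <= k < n.+2 | Q k) binomial_pmf n.+1 t k.
  by apply: sumr_ge0 => k _; exact: binomial_pmf_ge0.
have [ltx|lxt|/eqP] := ltgtP t x; last by rewrite (negPf tx).
- exists (fun k => ~~ (k <= m)%N); split.
    rewrite -(binomial_pmf_sum1 R n.+1 t) (bigID (fun k => k <= m)%N) /= -sE.
    by rewrite addrAC subrr add0r ger0_norm.
  move=> k; rewrite -ltnNge /m truncn_lt_nat // => xk.
  rewrite gtr0_norm ?subr_gt0 // mulrBr; apply: le_trans (ler_norm _).
  by rewrite lerD2r ltW.
- exists (fun k => (k <= m)%N); split.
    by rewrite sub0r normrN -sE ger0_norm // sE.
  move=> k; rewrite /m truncn_ge_nat // => kx.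
  rewrite distrC (distrC k%:R) gtr0_norm ?subr_gt0 // mulrBr.
  by apply: le_trans (ler_norm _); rewrite lerD2l lerN2.
Qed.

Lemma bernstein_step_cvg (R : realType) (t x : R) :
  0 <= t <= 1 -> x \in `[0, 1] -> t != x ->
  \sum_(0 <= k < (Num.truncn (n%:R * x)).+1) binomial_pmf n t k
    @[n --> \oo] --> ((t < x)%R%:R : R).
Proof.
move=> t01 x01 tx; rewrite -cvg_shiftS; set L : R := _%:R.
set K := ((x - t) ^+ 2)^-1.
have Kcvg : K * harmonic n @[n --> \oo] --> K * 0.
  by apply: cvgMl_tmp; exact: cvg_harmonic.
apply: (@squeeze_cvgr _ _ _ _ (fun n => L - K * harmonic n)
                              (fun n => L + K * harmonic n)).
- by apply: nearW => n; rewrite -ler_distlC; exact: bernstein_step_dist.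
- by rewrite -[X in _ --> X]subr0 -(mulr0 K); apply: cvgB => //; exact: cvg_cst.
- by rewrite -[X in _ --> X]addr0 -(mulr0 K); apply: cvgD => //; exact: cvg_cst.
Qed.

(* The convergence fails at every atom of the distribution, so x ranges over
   the points of [0, 1] outside the support, i.e. the points where the
   distribution function does not jump. *)
Theorem proposition4 (R : realType) (N : nat) (f : R -> R)
    (xs : 'I_N.+1 -> R) (hf : is_pmf_on f xs) (x : R)
    (hx : x \in `[0, 1]) (hatom : forall k : 'I_N.+1, x <> xs k) :
  moment_approx (pmf_moment f xs) alpha x @[alpha --> \oo] -->
    pmf_cdf f xs x.
Proof.
under eq_fun do rewrite moment_approx_pmf.
apply: cvg_big => [|i _]; first exact: add_continuous.
apply: cvgMl_tmp.
have := pmf_support01 hf i; rewrite in_itv /= => xi01.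
rewrite indicE mem_setE in_itv /=; have /andP[-> _] := xi01.
by apply: bernstein_step_cvg => //; apply/eqP => /esym; exact: hatom.
Qed.
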